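(* Let $d$ and $p$ be positive integers. The polynomial $$q(z,w)=(1+z+\dots+z^d)^p(1+w+\dots+w^d)^p$$ is Schur-positive. In other words, there exist nonnegative constants $\{c_{ij}\}_{i,j\ge 0}$, only finitely many of which are nonzero, with $$q(z,w)=\sum_{i,j\ge 0}c_{ij}\,S_{(i+j,j)}(z,w).$$ In fact, $$c_{ij}=a_{i+j}a_j-a_{i+j+1}a_{j-1},$$ where the $a_i$ are defined by $\sum_i a_it^i=(1+t+\dots+t^d)^p$ (with $a_i=0$ for $i<0$ and for $i>dp$).
   Context: $S_{(\lambda_1,\lambda_2)}(z,w)$, for integers $\lambda_1\ge\lambda_2\ge 0$, denotes the Schur polynomial in two variables associated to the partition $(\lambda_1,\lambda_2)$; explicitly $S_{(\lambda_1,\lambda_2)}(z,w)=z^{\lambda_1}w^{\lambda_2}+z^{\lambda_1-1}w^{\lambda_2+1}+\dots+z^{\lambda_2}w^{\lambda_1}$. A symmetric polynomial in $z,w$ is Schur-positive if it is a linear combination of Schur polynomials with nonnegative real coefficients. *)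

(* Defs.v *)
From mathcomp Require Import all_boot all_order all_algebra.
From mathcomp Require Import finmap mpoly.

Set Implicit Arguments.
Unset Strict Implicit.
Unset Printing Implicit Defensive.

Import Order.TTheory GRing.Theory Num.Theory.

Local Open Scope ring_scope.

Definition varz (R : realFieldType) : {mpoly R[2]} := 'X_ord0.
Definition varw (R : realFieldType) : {mpoly R[2]} := 'X_ord_max.

(* Meaningful for [l2 <= l1] only, so that the natural-number subtractions
   below are exact. *)
Definition schur2 (R : realFieldType) (l1 l2 : nat) : {mpoly R[2]} :=
  \sum_(k < (l1 - l2).+1) varz R ^+ (l1 - k) * varw R ^+ (l2 + k).

(* The coefficients are indexed by the pairs (l1, l2); the second condition
   restricts the index set to the partitions l1 >= l2 >= 0. *)
Definition schur_positive (R : realFieldType) (f : {mpoly R[2]}) : Prop :=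
  f \is symmetric /\
  exists c : {fsfun nat * nat -> R with 0},
    [/\ forall l, 0 <= c l,
        forall l, l \in finsupp c -> (l.2 <= l.1)%N
      & f = \sum_(l <- finsupp c) c l *: schur2 R l.1 l.2].

Definition geom (A : nzRingType) (d : nat) (x : A) : A :=
  \sum_(k < d.+1) x ^+ k.

Definition geom_prod (R : realFieldType) (d p : nat) : {mpoly R[2]} :=
  geom d (varz R) ^+ p * geom d (varw R) ^+ p.

(* Indexed by integers so that [acoef R d p (-1) = 0]; for [i > d * p] the
   coefficient of the polynomial is already [0]. *)
Definition acoef (R : realFieldType) (d p : nat) (i : int) : R :=
  match i with
  | Posz n => (geom d ('X : {poly R}) ^+ p)`_n
  | Negz _ => 0
  end.

(* Main.v *)
Require Import Defs.
From mathcomp Require Import all_boot all_order all_algebra.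
From mathcomp Require Import finmap mpoly.
From mathcomp Require Import perm zify ring lra.

Set Implicit Arguments.
Unset Strict Implicit.
Unset Printing Implicit Defensive.

Import Order.TTheory GRing.Theory Num.Theory.

Local Open Scope ring_scope.

(** Two independent facts make up the proof.

    The first is an identity valid for every univariate polynomial [P] with
    coefficients [a_i]: the product [P(z) P(w)] is the sum over the partitions
    [l1 >= l2] of the determinants [a_l1 a_l2 - a_(l1+1) a_(l2-1)] times the
    Schur polynomials [S_(l1,l2)]. Multiplied by [z - w], the Schur polynomial
    becomes the alternant [z^(l1+1) w^l2 - z^l2 w^(l1+1)], while the
    coefficient of [z^u w^j] in [(z - w) P(z) P(w)] is
    [a_(u-1) a_j - a_u a_(j-1)], which is antisymmetric in [(u, j)]. Folding
    the square of indices along its diagonal therefore expands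
    [(z - w) P(z) P(w)] in alternants, and [z - w] can be cancelled
    ([horner_mul_schur2]).

    The second is the sign of these determinants when [P] is
    [(1 + t + ... + t^d)^p]: they are nonnegative because the coefficient
    sequence of [P] is log-concave, a property that is preserved by
    multiplication by [1 + t + ... + t^d], that is, by replacing a sequence
    with its sums over a sliding window of length [d + 1]
    ([log_concave_window]). Sequences are indexed by [int] so that no boundary
    case arises at [0]; in particular [a_(-1) = 0] makes [0 <= a_l1 * a_0] an
    instance of log-concavity. *)

(** * Log-concave sequences *)

(** This is the nonnegativity of the 2 x 2 minors of the Toeplitz matrix of
    [a] on adjacent columns. Requiring it for all [n <= m], and not only for
    [m = n + 1], excludes internal zeros of a nonnegative sequence and makes
    the property stable under sums over a sliding window. *)
Definition log_concave (R : realDomainType) (a : int -> R) : Prop :=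
  forall m n : int, n <= m -> a n * a (m + 1) <= a (n + 1) * a m.

(** Moving the two indices towards each other by one each does not decrease the
    product, by log-concavity at the outer pair; this is iterated until [u] or
    [v] is reached. *)
Lemma log_concave_spread (R : realDomainType) (a : int -> R) (x u v y : int) :
  log_concave a -> x <= u -> x <= v -> x + y = u + v ->
  a x * a y <= a u * a v.
Proof.
move=> lc_a.
have gap (s : nat) : forall (z : int) (t : nat),
    a z * a (z + s%:Z + t%:Z) <= a (z + s%:Z) * a (z + t%:Z).
  elim: s => [|s IHs] z t; first by rewrite addr0.
  case: t => [|t]; first by rewrite !addr0 mulrC.
  have step := lc_a (z + s%:Z + t.+1%:Z) z ltac:(lia).
  have := IHs (z + 1) t.
  have -> : z + 1 + s%:Z + t%:Z = z + s%:Z + t.+1%:Z by lia.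
  have -> : z + 1 + s%:Z = z + s.+1%:Z by lia.
  have -> : z + 1 + t%:Z = z + t.+1%:Z by lia.
  apply: le_trans; apply: le_trans step.
  by have -> : z + s.+1%:Z + t.+1%:Z = z + s%:Z + t.+1%:Z + 1 by lia.
move=> le_xu le_xv eq_sum.
have := gap `|u - x|%N x `|v - x|%N.
have -> : x + `|u - x|%N%:Z + `|v - x|%N%:Z = y by lia.
have -> : x + `|u - x|%N%:Z = u by lia.
by have -> : x + `|v - x|%N%:Z = v by lia.
Qed.

(** Sliding the window from [i] to [i + 1] adds the entering term [a (i + 1)]
    and removes the leaving term [a (i - d)]. The desired difference of
    products of window sums thus splits into the contribution of the entering
    terms and that of the leaving terms. In each of them, expanding the
    remaining window sum reduces the claim, summand by summand, to two products
    whose indices have the same sum and which [log_concave_spread] compares. *)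
Lemma log_concave_window (R : realDomainType) (a : int -> R) (d : nat) :
  log_concave a -> log_concave (fun i => \sum_(k < d.+1) a (i - k%:Z)).
Proof.
move=> lc_a m n le_nm /=; set b := fun i : int => \sum_(k < d.+1) a (i - k%:Z).
have b_step i : b (i + 1) = b i + a (i + 1) - a (i - d%:Z).
  rewrite /b big_ord_recl big_ord_recr /= subr0.
  rewrite (eq_bigr (fun k : 'I_d => a (i - k%:Z))); first by ring.
  by move=> k _; congr a; rewrite /bump /=; lia.
rewrite -/(b n) -/(b m) -/(b (m + 1)) -/(b (n + 1)) !b_step.
have entering : b n * a (m + 1) <= a (n + 1) * b m.
  rewrite mulr_suml mulr_sumr; apply: ler_sum => k _.
  by apply: log_concave_spread => //; lia.
have leaving : a (n - d%:Z) * b m <= b n * a (m - d%:Z).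
  rewrite mulr_suml mulr_sumr; apply: ler_sum => k _.
  by have := ltn_ord k; move=> ?; apply: log_concave_spread => //; lia.
nra.
Qed.

(** * Coefficients of powers of a geometric sum *)

Definition icoef (R : nzRingType) (P : {poly R}) (i : int) : R :=
  if i is Posz n then P`_n else 0.

Lemma log_concave_geom_exp (R : realDomainType) (d p : nat) :
  log_concave (icoef (geom d ('X : {poly R}) ^+ p)).
Proof.
elim: p => [|p IHp].
  rewrite expr0 => m n le_nm.
  have one_ge0 k : 0 <= icoef (1 : {poly R}) k.
    by case: k => k //=; rewrite coef1.
  suff -> : icoef (1 : {poly R}) n * icoef 1 (m + 1) = 0 by rewrite mulr_ge0.
  case: m n le_nm => [m|m] [n|n] // _; rewrite /= ?mul0r //.
  by rewrite addn1 !coef1 mulr0.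
(* Multiplying by the geometric sum is taking window sums of coefficients. *)
set P := _ ^+ p in IHp; move: IHp => /(log_concave_window d) lc_w m n /lc_w.
have geomM i : \sum_(k < d.+1) icoef P (i - k%:Z)
    = icoef (geom d ('X : {poly R}) ^+ p.+1) i.
  rewrite exprS -/P /geom mulr_suml; case: i => [n0|n0] /=.
    rewrite coef_sum; apply: eq_bigr => k _; rewrite coefXnM.
    by case: ltnP => h; [case E: (_ - _) => [r|r] //=; lia
      | have -> : n0%:Z - k%:Z = (n0 - k)%N by lia].
  by apply: big1 => k _; case E: (_ - _) => [r|r] //=; lia.
by rewrite !geomM.
Qed.

(** * Expansion in Schur polynomials *)

(** This is the two-row Jacobi-Trudi determinant of [S_(l1,l2)] in which the
    complete symmetric polynomials are replaced by the coefficients of [P]. *)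
Definition jacobi_trudi (R : nzRingType) (P : {poly R}) (l1 l2 : nat) : R :=
  icoef P l1%:Z * icoef P l2%:Z - icoef P (l1%:Z + 1) * icoef P (l2%:Z - 1).

Lemma jacobi_trudi_eq0 (R : nzRingType) (P : {poly R}) (l1 l2 : nat) :
  (size P <= l1)%N -> jacobi_trudi P l1 l2 = 0.
Proof.
move=> le_P; rewrite /jacobi_trudi -PoszD addn1 /=.
by rewrite (nth_default _ le_P) (nth_default _ (leqW le_P)) !mul0r subr0.
Qed.

Lemma varzBw_neq0 (R : realFieldType) : varz R - varw R != 0.
Proof.
rewrite subr_eq0; apply/eqP => /(congr1 (mcoeff U_(ord0)%MM)).
rewrite !mcoeffX eqxx; case: eqP => [/mnmP/(_ ord0)|_ /eqP].
  by rewrite !mnm1E.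
by rewrite oner_eq0.
Qed.

(** Multiplying by [varz R - varw R] makes the sum telescope. *)
Lemma schur2_bialternant (R : realFieldType) (l1 l2 : nat) :
  (l2 <= l1)%N ->
  (varz R - varw R) * schur2 R l1 l2 =
  varz R ^+ l1.+1 * varw R ^+ l2 - varz R ^+ l2 * varw R ^+ l1.+1.
Proof.
move=> le_l; set z := varz R; set w := varw R.
pose f k := z ^+ (l1.+1 - k) * w ^+ (l2 + k).
rewrite /schur2 mulr_sumr (eq_bigr (fun k : 'I__ => f k - f k.+1)).
  rewrite -(big_mkord xpredT (fun k => f k - f k.+1)).
  rewrite (telescope_sumr_eq (fun k => - f k)) //; last by move=> k _; ring.
  rewrite /f subn0 addn0 opprK addrC.
  by congr (_ - z ^+ _ * w ^+ _); lia.
move=> [k /= lt_k] _; rewrite /f.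
have -> : (l1.+1 - k = (l1 - k).+1)%N by lia.
by rewrite subSS addnS !exprS; ring.
Qed.

(** When [f u j] is [e u j *: (z ^+ u * w ^+ j)] with [e] antisymmetric, each
    term [f u j + f j u] is a multiple of an alternant. *)
Lemma sum_square_fold (V : zmodType) (f : nat -> nat -> V) (n : nat) :
  \sum_(u < n) \sum_(j < n) f u j =
  \sum_(u < n) (f u u + \sum_(j < u) (f u j + f j u)).
Proof.
elim: n => [|n IHn]; first by rewrite !big_ord0.
rewrite [RHS]big_ord_recr /= -IHn big_ord_recr /=.
rewrite (eq_bigr (fun u : 'I_n => \sum_(j < n) f u j + f u n)); last first.
  by move=> u _; rewrite big_ord_recr.
rewrite [in LHS]big_ord_recr !big_split /= -addrA; congr (_ + _).
by rewrite [RHS]addrC -addrA addrCA.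
Qed.

(** The partitions [(l1, l2)] with [l2 <= l1 < n], in one sequence, so that the
    two indexings of the expansion, by [(l1, l2)] and by [(l1 - l2, l2)], are
    sums over it and over its image. *)
Definition partitions_below (n : nat) : seq (nat * nat) :=
  [seq (l1, l2) | l1 <- iota 0 n, l2 <- iota 0 l1.+1].

Lemma mem_partitions_below (n : nat) (l : nat * nat) :
  (l \in partitions_below n) = (l.2 <= l.1 < n)%N.
Proof.
apply/allpairsPdep/idP => [[l1 [l2 []]]|].
  by rewrite !mem_iota => ? ? -> /=; lia.
by move=> h; exists l.1, l.2; rewrite !mem_iota; split;
  [lia | lia | case: l {h}].
Qed.

Lemma uniq_partitions_below (n : nat) : uniq (partitions_below n).
Proof.
apply: allpairs_uniq_dep; first exact: iota_uniq.
  by move=> *; exact: iota_uniq.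
by move=> [x1 x2] [y1 y2] _ _ /= [-> ->].
Qed.

Lemma horner_alg_sum (R : comNzRingType) (A : algType R) (P : {poly R}) (x : A)
    (n : nat) :
  (size P <= n)%N -> horner_alg x P = \sum_(i < n) P`_i *: x ^+ i.
Proof.
move=> le_P.
have {1}-> : P = \poly_(i < n) P`_i.
  apply/polyP => i; rewrite coef_poly.
  by case: ltnP => // le_ni; rewrite nth_default // (leq_trans le_P).
rewrite poly_def linear_sum /=; apply: eq_bigr => i _.
by rewrite linearZ /= rmorphXn /= horner_algX mulr_algl.
Qed.

(** After multiplication by [varz R - varw R], which is not a zero divisor, both
    sides are sums of alternants. The coefficient [e u j] vanishes for [u = j]
    and is antisymmetric, and [e l.+1 j] is [jacobi_trudi P l j]: the shift by
    one is the one between a partition and the exponents of its alternant. *)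
Lemma horner_mul_schur2 (R : realFieldType) (P : {poly R}) :
  horner_alg (varz R) P * horner_alg (varw R) P =
  \sum_(l <- partitions_below (size P))
    jacobi_trudi P l.1 l.2 *: schur2 R l.1 l.2.
Proof.
set n := size P; set z := varz R; set w := varw R.
apply: (mulfI (varzBw_neq0 R)); rewrite -/z -/w.
pose e u j := icoef P (u%:Z - 1) * P`_j - P`_u * icoef P (j%:Z - 1).
(* One more term than [size P] is needed for the shifted coefficients. *)
have shift (x : {mpoly R[2]}) : x * horner_alg x P
    = \sum_(u < n.+1) icoef P (u%:Z - 1) *: x ^+ u.
  rewrite (horner_alg_sum x (leqnn _)) mulr_sumr big_ord_recl scale0r add0r.
  apply: eq_bigr => i _; rewrite -scalerAr -exprS; congr (_ *: _).
  by have -> : (bump 0 i)%:Z - 1 = i :> int by rewrite /bump /=; lia.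
have -> : (z - w) * (horner_alg z P * horner_alg w P) =
    \sum_(u < n.+1) \sum_(j < n.+1) e u j *: (z ^+ u * w ^+ j).
  rewrite mulrBl mulrA shift (mulrCA w) shift.
  rewrite (horner_alg_sum z (leqnSn _)) (horner_alg_sum w (leqnSn _)).
  rewrite !mulr_suml -sumrB; apply: eq_bigr => u _.
  rewrite !mulr_sumr -sumrB; apply: eq_bigr => j _.
  by rewrite -!scalerAl -!scalerAr !scalerA -scalerBl.
rewrite (sum_square_fold (fun u j => e u j *: (z ^+ u * w ^+ j))).
have diag u : e u u *: (z ^+ u * w ^+ u) = 0.
  by rewrite /e mulrC subrr scale0r.
rewrite big_ord_recl big_ord0 diag !add0r.
have sum_iota k (F : nat -> {mpoly R[2]}) :
    \sum_(i <- iota 0 k) F i = \sum_(i < k) F i.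
  by rewrite -(big_mkord xpredT) /index_iota subn0.
rewrite /partitions_below mulr_sumr big_allpairs_dep sum_iota.
apply: eq_bigr => l _; rewrite lift0 diag add0r sum_iota.
apply: eq_bigr => -[j /= lt_jl] _.
rewrite -scalerAr schur2_bialternant // scalerBr -scaleNr /e /jacobi_trudi.
have -> : l.+1%:Z - 1 = l :> int by lia.
rewrite -!PoszD addn1 /=; congr (_ + _ *: _).
by ring.
Qed.

(** * Positivity for powers of a geometric sum *)

(** A sum over [finsupp c] can be taken over any duplicate-free sequence that
    contains the support, since the additional terms are zero. *)
Lemma fsfun_of_seq (R : pzRingType) (V : lmodType R) (T : choiceType)
    (f : T -> R) (r : seq T) (F : T -> V) :
  uniq r -> (forall x, f x != 0 -> x \in r) ->
  exists c : {fsfun T -> R with 0},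
    c =1 f /\ \sum_(x <- finsupp c) c x *: F x = \sum_(x <- r) f x *: F x.
Proof.
move=> uniq_r supp_f.
pose c : {fsfun T -> R with 0} := [fsfun x in seq_fset tt r => f x | 0].
have cE : c =1 f.
  move=> x; rewrite fsfun_fun seq_fsetE; case: ifPn => // /negP x_r.
  by apply/esym/eqP/negPn/negP => /supp_f.
exists c; split => //.
rewrite [RHS](bigID (fun x => x \in finsupp c)) /= [X in _ + X]big1 => [|x].
  rewrite addr0 -[RHS]big_filter; under eq_bigr do rewrite cE.
  apply: perm_big; apply: uniq_perm; rewrite ?fset_uniq ?filter_uniq // => x.
  rewrite mem_filter; case: (boolP (x \in finsupp c)) => //=.
  by rewrite mem_finsupp cE => /supp_f ->.
by rewrite memNfinsupp cE => /eqP ->; rewrite scale0r.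
Qed.

Lemma geom_prod_horner (R : realFieldType) (d p : nat) :
  geom_prod R d p = horner_alg (varz R) (geom d 'X ^+ p)
                    * horner_alg (varw R) (geom d 'X ^+ p).
Proof.
have geomE (x : {mpoly R[2]}) :
    horner_alg x (geom d 'X ^+ p) = geom d x ^+ p.
  rewrite rmorphXn /geom rmorph_sum /=; congr (_ ^+ p).
  by apply: eq_bigr => k _; rewrite rmorphXn /= horner_algX.
by rewrite !geomE.
Qed.

Lemma geom_prod_sym (R : realFieldType) (d p : nat) :
  geom_prod R d p \is symmetric.
Proof.
have msym_geom (s : 'S_2) x : msym s (geom d x ^+ p) = geom d (msym s x) ^+ p.
  rewrite rmorphXn /geom rmorph_sum /=; congr (_ ^+ p).
  by apply: eq_bigr => k _; rewrite rmorphXn.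
apply/issymP => s; rewrite /geom_prod msymM !msym_geom.
have msymX i : msym s ('X_i : {mpoly R[2]}) = 'X_(s i).
  rewrite msymX; congr mpolyX; apply/mnmP => j; rewrite mnmE !mnm1E.
  by rewrite -(inj_eq (@perm_inj _ s)) permKV.
rewrite /varz /varw !msymX.
have ord2E (i : 'I_2) : i = ord0 \/ i = ord_max.
  by case: i => [[|[|//]] lt_i]; [left | right]; apply: val_inj.
have : s ord0 != s ord_max by rewrite (inj_eq perm_inj).
case: (ord2E (s ord0)) (ord2E (s ord_max)) => -> [] -> //= _.
exact: mulrC.
Qed.

(** This is log-concavity at the indices [l2 - 1 <= l1]; for [l2 = 0] the
    subtracted product is zero because the coefficient of index [-1] is. *)
Lemma jacobi_trudi_geom_ge0 (R : realDomainType) (d p l1 l2 : nat) :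
  (l2 <= l1)%N -> 0 <= jacobi_trudi (geom d ('X : {poly R}) ^+ p) l1 l2.
Proof.
move=> le_l; rewrite subr_ge0 mulrC [X in _ <= X]mulrC.
have := @log_concave_geom_exp R d p l1%:Z (l2%:Z - 1) ltac:(lia).
by rewrite subrK.
Qed.

Theorem propositionB5 (R : realFieldType) (d p : nat)
    (hd : (0 < d)%N) (hp : (0 < p)%N) :
  schur_positive (geom_prod R d p) /\
  exists c : {fsfun nat * nat -> R with 0},
    [/\ forall i j : nat, 0 <= c (i, j),
        geom_prod R d p =
          \sum_(ij <- finsupp c) c ij *: schur2 R (ij.1 + ij.2) ij.2
      & forall i j : nat,
          c (i, j) =
            acoef R d p (i%:Z + j%:Z) * acoef R d p j%:Z -
            acoef R d p (i%:Z + j%:Z + 1) * acoef R d p (j%:Z - 1)].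
Proof.
set P : {poly R} := geom d 'X ^+ p.
have expansion := horner_mul_schur2 P; rewrite -geom_prod_horner in expansion.
split.
  split; first exact: geom_prod_sym.
  pose f (l : nat * nat) :=
    if (l.2 <= l.1)%N then jacobi_trudi P l.1 l.2 else 0.
  have supp_f l : f l != 0 -> l \in partitions_below (size P).
    rewrite mem_partitions_below /f.
    case: (leqP l.2 l.1) => [le_l|_]; last by rewrite eqxx.
    by rewrite ltnNge; apply: contra => /jacobi_trudi_eq0 ->.
  have [c [cE c_sum]] := fsfun_of_seq (fun l => schur2 R l.1 l.2)
    (uniq_partitions_below _) supp_f.
  exists c; split => [l|l|].
  - by rewrite cE /f; case: ifP => // le_l; exact: jacobi_trudi_geom_ge0.
  - rewrite mem_finsupp cE => /supp_f.
    by rewrite mem_partitions_below => /andP[].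
  - rewrite c_sum expansion; apply: eq_big_seq => l.
    by rewrite mem_partitions_below /f => /andP[->].
(* The second indexing is the image of the partitions under [g]. *)
pose g (l : nat * nat) := ((l.1 - l.2)%N, l.2).
pose f (ij : nat * nat) := jacobi_trudi P (ij.1 + ij.2) ij.2.
have supp_f ij : f ij != 0 -> ij \in map g (partitions_below (size P)).
  move=> f_neq0; apply/mapP; exists ((ij.1 + ij.2)%N, ij.2).
    rewrite mem_partitions_below /= leq_addl ltnNge.
    by apply: contra f_neq0 => /jacobi_trudi_eq0 => /(_ ij.2) h; apply/eqP.
  by rewrite /g /= addnK; case: ij {f_neq0}.
have uniq_g : uniq (map g (partitions_below (size P))).
  rewrite map_inj_in_uniq ?uniq_partitions_below //.
  move=> [l1 l2] [m1 m2]; rewrite !mem_partitions_below /g /=.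
  by move=> ? ? [] ? ?; congr (_, _); lia.
have [c [cE c_sum]] := fsfun_of_seq
  (fun ij => schur2 R (ij.1 + ij.2) ij.2) uniq_g supp_f.
exists c; split => [i j||i j].
- by rewrite cE; apply: jacobi_trudi_geom_ge0; rewrite leq_addl.
- rewrite c_sum big_map expansion; apply: eq_big_seq => l.
  by rewrite mem_partitions_below /f /g /= => /andP[le_l _]; rewrite subnK.
- rewrite cE /f /jacobi_trudi.
  have acoefE k : acoef R d p k = icoef P k by case: k.
  by rewrite !acoefE.
Qed.
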